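(* Let $R$ be a unital associative ring. The following statements are equivalent: (a) Any idempotent of $R$ that is isomorphic to a left semicentral idempotent of $R$ is itself left semicentral. (a') Any idempotent of $R$ that is isomorphic to a right semicentral idempotent of $R$ is itself right semicentral. (b) Any idempotent of $R$ that is isomorphic to a left or right semicentral idempotent of $R$ is conjugated to it. (c) $R$ is Dedekind-finite.
   Context: Rings are associative with unit, not necessarily commutative. An idempotent $e\in R$ is left semicentral if $(1-e)Re=0$, and right semicentral if $eR(1-e)=0$. Two idempotents $e,f\in R$ are isomorphic if $eR\simeq fR$ as right $R$-modules (equivalently, there are $a,b\in R$ with $e=ab$ and $f=ba$). Two idempotents $e,f\in R$ are conjugated (conjugate) if there is an invertible element $u\in R$ with $f=ueu^{-1}$. The ring $R$ is Dedekind-finite if for all $a,b\in R$, $ab=1$ implies $ba=1$. *)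

(* Defs.v *)
From HB Require Import structures.
From mathcomp Require Import all_boot all_algebra.
From mathcomp Require Import boolp.

Set Implicit Arguments.
Unset Strict Implicit.
Unset Printing Implicit Defensive.

Import GRing.Theory.

Local Open Scope ring_scope.

(* Right R-modules are left modules over the converse ring R^c; the right     *)
(* module R_R is the regular module (R^c)^o, in which r *: x is x * r in R.   *)
Definition regular_right (R : pzRingType) : lmodType R^c := (R^c)^o.

Definition principal_pred (R : pzRingType) (e : R) : {pred regular_right R} :=
  [pred x : R | `[< exists r : R, x = e * r >]].

Lemma principal_submod_closed (R : pzRingType) (e : R) :
  submod_closed (principal_pred e).
Proof.
split; first by apply/asboolP; exists 0; rewrite mulr0.
move=> a u v /asboolP[r ->] /asboolP[s ->]; apply/asboolP.
by exists (r * a + s); rewrite mulrDr mulrA.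
Qed.

HB.instance Definition _ (R : pzRingType) (e : R) :=
  GRing.isSubmodClosed.Build R^c (regular_right R) (principal_pred e)
    (principal_submod_closed e).

Record principal (R : pzRingType) (e : R) := Principal {
  principal_val :> regular_right R;
  principal_valP : principal_val \in principal_pred e }.

HB.instance Definition _ (R : pzRingType) (e : R) :=
  [isSub for @principal_val R e].
HB.instance Definition _ (R : pzRingType) (e : R) :=
  [Choice of principal e by <:].
HB.instance Definition _ (R : pzRingType) (e : R) :=
  [SubChoice_isSubLmodule of principal e by <:].

Lemma principal_scaleE (R : pzRingType) (e : R) (r : R^c) (x : principal e) :
  val (r *: x) = (val x : R) * (r : R) :> R.
Proof. by []. Qed.

Section Idempotents.

Variable R : pzRingType.
Implicit Types e f : R.

Definition idem e : Prop := e * e = e.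

Definition left_semicentral e : Prop := forall r : R, (1 - e) * r * e = 0.

Definition right_semicentral e : Prop := forall r : R, e * r * (1 - e) = 0.

Definition isomorphic e f : Prop :=
  exists phi : {linear principal e -> principal f}, bijective phi.

Definition conjugated e f : Prop :=
  exists u v : R, [/\ u * v = 1, v * u = 1 & f = u * e * v].

Definition dedekind_finite : Prop := forall a b : R, a * b = 1 -> b * a = 1.

End Idempotents.

(* Main.v *)
Require Import Defs.
From HB Require Import structures.
From mathcomp Require Import all_boot all_algebra.
From mathcomp Require Import boolp.

(** The conditions (a), (a') and (b) are each compared with (c).

    Each of them implies Dedekind-finiteness because of the idempotent 1,
    which is semicentral on both sides.  If a * b = 1, then b * a is an
    idempotent isomorphic to 1, so it is left semicentral, right semicentral or
    conjugated to 1; every one of these forces b * a = 1.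

    Conversely, let e = a * b and f = b * a with f left semicentral. Since R f
    = f R f, the element a f lies in the corner ring f R f, where it has the
    left inverse f b f. A corner of a Dedekind-finite ring is Dedekind-finite
    ([dedekind_finite_corner]), so the product in the other order, which is e
    f, is also f ([left_semicentral_iso_mul]). Semicentrality alone gives f e =
    e, hence e R = f R. Two idempotents generating the same right ideal are
    conjugated by a unipotent element ([conjugated_same_ideal]), and left
    semicentrality of e only says that the right ideal e R is two-sided, so it
    passes from f to e ([left_semicentral_same_ideal]). The right-handed
    results are the left-handed ones in the converse ring. Module isomorphisms
    e R -> f R enter only through the pairs a, b ([isomorphicP]). *)

Set Implicit Arguments.
Unset Strict Implicit.
Unset Printing Implicit Defensive.

Import GRing.Theory.

Local Open Scope ring_scope.

Section Isomorphism.

Variable R : pzRingType.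
Implicit Types e f a b : R.

Lemma mem_principal e r : (e * r : regular_right R) \in principal_pred e.
Proof. by apply/asboolP; exists r. Qed.

Definition principal_elt e r : principal e := Principal (mem_principal e r).

Lemma principal_idl e (x : principal e) :
  idem e -> e * (val x : R) = val x.
Proof. by case: x => x /= /asboolP[r ->] he; rewrite mulrA he. Qed.

Lemma linear_principalE e f (phi : {linear principal e -> principal f})
    (x : principal e) :
  idem e -> val (phi x) = (val (phi (principal_elt e 1)) : R) * val x :> R.
Proof.
move=> he; rewrite -[RHS]principal_scaleE -linearZ.
congr (val (phi _)); apply: val_inj.
by rewrite principal_scaleE /= mulr1 principal_idl.
Qed.

(** Left multiplication by b sends a b R into b a R, because b (a b) = (b a) b. *)
Lemma lmul_principal_mem a b (x : principal (a * b)) :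
  (b * (val x : R) : regular_right R) \in principal_pred (b * a).
Proof.
case: x => x /= /asboolP[r ->]; apply/asboolP.
by exists (b * r); rewrite !mulrA.
Qed.

Definition lmul_principal a b (x : principal (a * b)) : principal (b * a) :=
  Principal (lmul_principal_mem x).

Lemma lmul_principal_linear a b : linear (@lmul_principal a b).
Proof.
move=> r x y; apply: val_inj.
by rewrite /= mulrDr; congr (_ + _); exact: (@mulrA R b (val x) r).
Qed.

HB.instance Definition _ a b :=
  GRing.isLinear.Build R^c (principal (a * b)) (principal (b * a)) *:%R
    (@lmul_principal a b) (@lmul_principal_linear a b).

Lemma lmul_principalK a b :
  idem (a * b) -> cancel (@lmul_principal a b) (@lmul_principal b a).
Proof.
by move=> he x; apply: val_inj; rewrite /= mulrA principal_idl.
Qed.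

(** A linear map e R -> f R is left multiplication by the image of e, so an
    isomorphism and its inverse are encoded by a pair of elements. *)
Lemma isomorphicP e f : idem e -> idem f ->
  isomorphic e f <-> exists a b, e = a * b /\ f = b * a.
Proof.
move=> he hf; split=> [[phi [psi phiK psiK]]|[a [b [def_e def_f]]]].
  pose b : R := val (phi (principal_elt e 1)).
  pose a : R := val (psi (principal_elt f 1)).
  have psi_linear : linear psi := can2_linear phiK psiK.
  pose psiL : {linear principal f -> principal e} :=
    HB.pack psi (GRing.isLinear.Build _ _ _ _ psi psi_linear).
  exists a, b; split.
    have := @linear_principalE _ _ psiL (phi (principal_elt e 1)) hf.
    by rewrite /= phiK /= mulr1.
  have := @linear_principalE _ _ phi (psi (principal_elt f 1)) he.
  by rewrite psiK /= mulr1.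
subst e f; exists (@lmul_principal a b); exists (@lmul_principal b a).
  exact: lmul_principalK.
exact: lmul_principalK.
Qed.

End Isomorphism.

Section LeftSemicentral.

Variable R : pzRingType.
Implicit Types e f a b x y : R.

Lemma left_semicentralE f r : left_semicentral f -> f * r * f = r * f.
Proof.
move=> /(_ r); rewrite -mulrA mulrBl mul1r mulrA.
by move/subr0_eq.
Qed.

(** An element x of the corner ring f R f is completed to the element
    x + (1 - f) of R, and products of completions are completions of products. *)
Lemma dedekind_finite_corner f x y : dedekind_finite R -> idem f ->
    f * x = x -> x * f = x -> f * y = y -> y * f = y ->
  x * y = f -> y * x = f.
Proof.
move=> dfR hf fx xf fy yf xy.
have completeM u v : u * f = u -> f * v = v ->
    (u + (1 - f)) * (v + (1 - f)) = u * v + (1 - f).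
  move=> uf fv; rewrite mulrDl (mulrDr u) (mulrDr (1 - f)).
  have -> : u * (1 - f) = 0 by rewrite mulrBr mulr1 uf subrr.
  have -> : (1 - f) * v = 0 by rewrite mulrBl mul1r fv subrr.
  have -> : (1 - f) * (1 - f) = 1 - f.
    by rewrite mulrBr mulr1 mulrBl mul1r hf subrr subr0.
  by rewrite addr0 add0r.
have /dfR : (x + (1 - f)) * (y + (1 - f)) = 1.
  by rewrite completeM // xy addrC subrK.
rewrite completeM // => yx1; apply: (addIr (1 - f)).
by rewrite yx1 addrC subrK.
Qed.

(** The two equalities together say that e R = f R. *)
Lemma left_semicentral_iso_mul a b : dedekind_finite R ->
    idem (a * b) -> idem (b * a) -> left_semicentral (b * a) ->
  (b * a) * (a * b) = a * b /\ (a * b) * (b * a) = b * a.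
Proof.
move=> dfR; set e := a * b; set f := b * a => he hf scf.
have afb : a * f * b = e by rewrite -[RHS]he /e /f !mulrA.
have ba : b * a = f by [].
clearbody e f.
split; first by rewrite -afb !mulrA left_semicentralE.
pose x := a * f; pose y := f * b * f.
have yx : y * x = f.
  by rewrite /y /x -!mulrA (mulrA f a f) left_semicentralE // (mulrA b a f) ba
    !hf.
have <- : x * y = e * f.
  by rewrite /x /y !mulrA -(mulrA a f f) hf afb.
apply: (dedekind_finite_corner dfR hf _ _ _ _ yx).
- by rewrite /y !mulrA hf.
- by rewrite /y -!mulrA hf.
- by rewrite /x mulrA left_semicentralE.
- by rewrite /x -mulrA hf.
Qed.

Lemma left_semicentral_same_ideal e f :
  f * e = e -> e * f = f -> left_semicentral f -> left_semicentral e.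
Proof.
move=> fe ef scf r.
have ref : r * e = f * (r * e).
  by rewrite -fe !mulrA left_semicentralE.
by rewrite -mulrA mulrBl mul1r ref [e * _]mulrA ef subrr.
Qed.

(** When e R = f R the difference e - f has square zero, and the conjugating
    unit is 1 + (e - f). *)
Lemma conjugated_same_ideal e f :
  idem e -> idem f -> f * e = e -> e * f = f -> conjugated e f.
Proof.
move=> he hf fe ef; pose d := e - f.
have de : d * e = 0 by rewrite mulrBl he fe subrr.
have df : d * f = 0 by rewrite mulrBl ef hf subrr.
have ed : e * d = d by rewrite mulrBr he ef.
have dd : d * d = 0 by rewrite {2}/d mulrBr de df subrr.
exists (1 + d), (1 - d); split.
- by rewrite mulrDl mul1r mulrBr mulr1 dd subr0 subrK.
- by rewrite mulrBl mul1r mulrDr mulr1 dd addr0 addrK.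
- by rewrite mulrDl mul1r de addr0 mulrBr mulr1 ed /d subKr.
Qed.

Lemma left_semicentral_iso a b : dedekind_finite R ->
    idem (a * b) -> idem (b * a) -> left_semicentral (b * a) ->
  left_semicentral (a * b) /\ conjugated (a * b) (b * a).
Proof.
move=> dfR he hf scf.
have [fe ef] := left_semicentral_iso_mul dfR he hf scf.
split; first exact: left_semicentral_same_ideal fe ef scf.
exact: conjugated_same_ideal.
Qed.

End LeftSemicentral.

(** In the converse ring the factors a and b trade places. *)
Lemma right_semicentral_iso (R : pzRingType) (a b : R) : dedekind_finite R ->
    idem (a * b) -> idem (b * a) -> right_semicentral (b * a) ->
  right_semicentral (a * b) /\ conjugated (a * b) (b * a).
Proof.
move=> dfR he hf scf.
have dfRc : dedekind_finite R^c by move=> x y; exact: dfR.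
have scfc : @left_semicentral R^c (b * a).
  by move=> r; rewrite -[RHS](scf r) -[RHS]mulrA.
have [sce [u [v [uv vu def_f]]]] :=
  @left_semicentral_iso R^c b a dfRc he hf scfc.
split; first by move=> r; rewrite -[RHS](sce r) -[LHS]mulrA.
by exists v, u; split=> //; rewrite -[LHS]/((a : R^c) * b) def_f -[RHS]mulrA.
Qed.

Section IdempotentsIsomorphicToOne.

Variables (R : pzRingType) (a b : R).
Hypothesis ab1 : a * b = 1.

Lemma idem_swap_one : idem (b * a).
Proof. by rewrite /idem mulrA -(mulrA b a b) ab1 mulr1. Qed.

Lemma isomorphic_swap_one : isomorphic (b * a) 1.
Proof.
apply/isomorphicP; [exact: idem_swap_one | exact: mulr1 |].
by exists b, a; rewrite ab1.
Qed.

(** Evaluate semicentrality at a: the identity (1 - b a) a (b a) = 0, multiplied by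
    b on the right, becomes 1 - b a = 0. *)
Lemma left_semicentral_swap_one : left_semicentral (b * a) -> b * a = 1.
Proof.
move=> /(_ a) /(congr1 (fun z => z * b)); rewrite mul0r -!mulrA ab1 mulr1 ab1.
by rewrite mulr1 => /subr0_eq.
Qed.

(** Evaluate semicentrality at b: the identity (b a) b (1 - b a) = 0, multiplied by
    a on the left, becomes 1 - b a = 0. *)
Lemma right_semicentral_swap_one : right_semicentral (b * a) -> b * a = 1.
Proof.
move=> /(_ b) /(congr1 (fun z => a * z)); rewrite mulr0 !mulrA ab1 mul1r ab1.
by rewrite mul1r => /subr0_eq.
Qed.

End IdempotentsIsomorphicToOne.

Lemma conjugated_one (R : pzRingType) (e : R) : conjugated e 1 -> e = 1.
Proof.
move=> [u [v [_ vu def1]]].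
by rewrite -[e]mul1r -[1 * e]mulr1 -{1}vu -{1}vu -!mulrA (mulrA u) (mulrA _ v)
  -def1 mul1r vu.
Qed.

Lemma left_semicentral1 (R : pzRingType) : left_semicentral (1 : R).
Proof. by move=> r; rewrite subrr !mul0r. Qed.

Lemma right_semicentral1 (R : pzRingType) : right_semicentral (1 : R).
Proof. by move=> r; rewrite subrr mulr0. Qed.

Theorem theorem6 (R : pzRingType) :
  [<->
    (* a *)
    forall e f : R, idem e -> idem f -> isomorphic e f ->
      left_semicentral f -> left_semicentral e;
    (* a' *)
    forall e f : R, idem e -> idem f -> isomorphic e f ->
      right_semicentral f -> right_semicentral e;
    (* b *)
    forall e f : R, idem e -> idem f -> isomorphic e f ->
      left_semicentral f \/ right_semicentral f -> conjugated e f;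
    (* c *)
    dedekind_finite R ].
Proof.
have idem1 : idem (1 : R) by exact: mulr1.
tfae.
- move=> left_iso.
  have dfR : dedekind_finite R.
    move=> a b ab1; apply: left_semicentral_swap_one (ab1) _.
    apply: left_iso (idem_swap_one ab1) idem1 (isomorphic_swap_one ab1) _.
    exact: left_semicentral1.
  move=> e f he hf /(isomorphicP he hf)[a [b [def_e def_f]]]; subst e f.
  by case/(right_semicentral_iso dfR he hf).
- move=> right_iso.
  have dfR : dedekind_finite R.
    move=> a b ab1; apply: right_semicentral_swap_one (ab1) _.
    apply: right_iso (idem_swap_one ab1) idem1 (isomorphic_swap_one ab1) _.
    exact: right_semicentral1.
  move=> e f he hf /(isomorphicP he hf)[a [b [def_e def_f]]]; subst e f.
  case; first by case/(left_semicentral_iso dfR he hf).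
  by case/(right_semicentral_iso dfR he hf).
- move=> conj_iso a b ab1; apply: conjugated_one.
  apply: conj_iso (idem_swap_one ab1) idem1 (isomorphic_swap_one ab1) _.
  by left; exact: left_semicentral1.
- move=> dfR e f he hf /(isomorphicP he hf)[a [b [def_e def_f]]]; subst e f.
  by case/(left_semicentral_iso dfR he hf).
Qed.
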